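(* Suppose $\mu:=\mathbb{E}[\xi]\in(0,\infty)$. If, for some $t\in\mathbb{R}$, $N(t)<\infty$ almost surely or $\rho(t)<\infty$ almost surely, then $$\lim_{t\to\infty}\frac{N(t)}{t}=\lim_{t\to\infty}\frac{\rho(t)}{t}=\frac{1}{\mu}\quad\text{almost surely}.$$
   Context: Let $(\xi_1,\eta_1),(\xi_2,\eta_2),\ldots$ be independent copies of an $\mathbb{R}^2$-valued random vector $(\xi,\eta)$ with arbitrarily dependent components. Put $S_0:=0$, $S_n:=\xi_1+\ldots+\xi_n$ for $n\in\mathbb{N}=\{1,2,\ldots\}$, and $T_n:=S_{n-1}+\eta_n$ for $n\in\mathbb{N}$ (the globally perturbed random walk). For $t\in\mathbb{R}$ define the number of visits $N(t):=\sum_{n\ge1}\mathbf{1}_{\{T_n\le t\}}$ to $(-\infty,t]$ and the last exit time $\rho(t):=\sup\{n\ge1: T_n\le t\}$, with the convention $\sup\varnothing=0$. *)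

(* Defs.v *)
From mathcomp Require Import all_boot all_order all_algebra.
From mathcomp Require Import finmap.
From mathcomp Require Import all_classical all_reals all_analysis.
From mathcomp Require Import measurable_realfun.
Import Order.TTheory GRing.Theory Num.Theory.
Import numFieldNormedType.Exports.

Set Implicit Arguments.
Unset Strict Implicit.
Unset Printing Implicit Defensive.

Local Open Scope classical_set_scope.
Local Open Scope ring_scope.

Definition mutually_independent d d' (T : measurableType d)
    (T' : measurableType d') (R : realType) (P : probability T R)
    (I : choiceType) (D : set I) (X : I -> {RV P >-> T'}) : Prop :=
  forall (J : {fset I}) (B : I -> set T'),
    [set` J] `<=` D -> (forall j, j \in J -> measurable (B j)) ->
    P (\bigcap_(j in [set` J]) (X j @^-1` B j)) =
    (\prod_(j <- J) P (X j @^-1` B j))%E.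

(* The laws are compared on measurable sets only, because the value of
   [distribution P X] on a non-measurable set is unspecified. *)
Definition same_law d d' (T : measurableType d) (T' : measurableType d')
    (R : realType) (P : probability T R) (X Y : {RV P >-> T'}) : Prop :=
  forall B : set T', measurable B -> distribution P X B = distribution P Y B.

(* Sequences are indexed from 1: the value of [X] at index 0 is never used. *)
Definition independent_copies d d' (T : measurableType d)
    (T' : measurableType d') (R : realType) (P : probability T R)
    (X : nat -> {RV P >-> T'}) (X0 : {RV P >-> T'}) : Prop :=
  mutually_independent [set n | (1 <= n)%N] X /\
  (forall n, (1 <= n)%N -> same_law (X n) X0).

Section perturbed_random_walk.
Context d (T : measurableType d) (R : realType).
(* [X n w] is the pair (xi_n(w), eta_n(w)). *)
Variable X : nat -> T -> R * R.

Definition random_walk (n : nat) (w : T) : R :=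
  \sum_(1 <= k < n.+1) (X k w).1.

(* Only meaningful for [1 <= n]. *)
Definition perturbed_walk (n : nat) (w : T) : R :=
  random_walk n.-1 w + (X n w).2.

Definition visits (t : R) (w : T) : \bar R :=
  (\sum_(1 <= n <oo) ((perturbed_walk n w <= t)%R%:R)%:E)%E.

(* Adjoining 0 to the set implements the convention that the supremum of the
   empty set is 0; it changes nothing otherwise. *)
Definition last_exit (t : R) (w : T) : \bar R :=
  ereal_sup (0%E |` [set n%:R%:E | n in
    [set n : nat | (1 <= n)%N /\ perturbed_walk n w <= t]]).

End perturbed_random_walk.

(* Main.v *)
Require Import Defs.
From mathcomp Require Import all_boot all_order all_algebra.
From mathcomp Require Import finmap.
From mathcomp Require Import all_classical all_reals all_analysis.
From mathcomp Require Import measurable_realfun.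
From mathcomp Require Import ring lra.
Import Order.TTheory GRing.Theory Num.Theory.
Import numFieldNormedType.Exports.
Local Open Scope classical_set_scope.
Local Open Scope ring_scope.

(** The perturbed walk is T_(n+1) = S_n + V_n, where S_n is a sum of n copies
    of xi and V_n = eta_(n+1).  Both limits follow from three almost sure
    linear estimates, valid for every e > 0:
    - |S_n - mu n| <= C + e n, the strong law of large numbers;
    - V_n >= - C - e n;
    - at most C + e n of the variables V_0, ..., V_(n-1) exceed some K.
    By the first two, T_n <= t forces n <= t / a + O(1) for each slope a < mu,
    which bounds the last exit time from above.  By the first and third,
    T_n <= t holds for all n up to t / a, a > mu, apart from a small
    proportion of them, which bounds the number of visits from below.  As the
    visits never outnumber the last exit time, both quantities are squeezed
    onto t / mu ([visits_last_exit_cvg]).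

    Only the second estimate depends on the assumption that N(t) or rho(t) is
    finite for one t.  If the probabilities P(V_0 < - 2 mu n) had a divergent
    sum, then by the second Borel-Cantelli lemma V_n < - 2 mu n infinitely
    often, so that T_(n+1) <= C - mu n / 2 infinitely often and N(t), rho(t)
    are infinite for all t.  Hence the sum converges; by monotonicity
    of the tail, P(V_0 < - e n) is then summable for every e > 0, and the first
    Borel-Cantelli lemma applies ([lower_bound_dichotomy]).  The third estimate
    is the strong law for the indicators of V_n > K, whose mean is small for
    large K ([exceedances_linear]).

    The strong law is obtained without truncation, from the fact that an i.i.d.
    sum with negative mean is bounded above ([negative_drift_bounded]).  Let
    M_n be the maximum of the first n partial sums and 0, and M'_n the same for
    the shifted sequence, so that M_(n+1) = max(0, Y_0 + M'_n).  On the
    shift-invariant event E that the sums are unbounded above, M_n and M'_n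
    have equal integrals, so M_(n+1) - M'_n has a nonnegative integral; it is
    dominated by |Y_0| and tends to Y_0 on E.  Hence the integral of Y_0 over E
    is nonnegative.  Since Y_0 is independent of E this integral is P(E) E(Y_0),
    so P(E) = 0 when E(Y_0) < 0.  Applied to Y - m - e and to m - Y - e, this
    gives the strong law in linear form ([strong_law_linear]). *)

Set Implicit Arguments.
Unset Strict Implicit.
Unset Printing Implicit Defensive.

(** * The sequence space and i.i.d. sequences *)

Section sequence_space.
Context d (S : measurableType d).

(** Constraining a whole initial segment matches the product formula that defines
    [iid] below. *)
Definition cylinders : set (set (nat -> S)) :=
  [set A | exists n (B : nat -> set S), (forall i, measurable (B i)) /\
     A = [set x | forall i, (i < n)%N -> B i (x i)]].

Definition seq_space := g_sigma_algebraType cylinders.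

Definition seq_shift (x : seq_space) : seq_space := fun n => x n.+1.

Lemma setI_closed_cylinders : setI_closed cylinders.
Proof.
move=> _ _ [n [B [mB ->]]] [n' [B' [mB' ->]]].
pose C k (D : nat -> set S) i := if (i < k)%N then D i else setT.
exists (maxn n n'), (fun i => C n B i `&` C n' B' i); split.
  by move=> i; apply: measurableI; rewrite /C; case: ifP.
apply/seteqP; split => x /=.
  by move=> [xB xB'] i _; split; rewrite /C; case: ifP => // /[dup]; auto.
move=> xC; split => i ik.
  by have [] := xC i; rewrite ?leq_max ?ik//= /C ik.
by have [] := xC i; rewrite ?leq_max ?ik ?orbT//= /C ik.
Qed.

Lemma measurable_coord i : measurable_fun [set: seq_space] (fun x => x i : S).
Proof.
move=> _ B mB; rewrite setTI; apply: sub_gen_smallest.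
exists i.+1, (fun j => if j == i then B else setT); split.
  by move=> j; case: ifP.
apply/seteqP; split => x /=.
  by move=> xB j _; case: eqP => // ->.
by move=> /(_ i (ltnSn i)); rewrite eqxx.
Qed.

Lemma measurable_to_seq d' (T : measurableType d') (f : T -> seq_space) :
  (forall i, measurable_fun setT (fun w => f w i : S)) -> measurable_fun setT f.
Proof.
move=> mf; apply: (@measurability _ _ _ _ setT f cylinders) => //.
move=> _ [_ [n [B [mB ->]]] <-]; rewrite setTI.
have -> : f @^-1` [set x | forall i, (i < n)%N -> B i (x i)] =
    \bigcap_(i in `I_n) ((fun w => f w i : S) @^-1` B i).
  by apply/seteqP; split => w /=.
apply: bigcap_measurableType => i _.
by rewrite -[X in measurable X]setTI; exact: mf.
Qed.

Lemma measurable_seq_shift : measurable_fun [set: seq_space] seq_shift.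
Proof. by apply: measurable_to_seq => i; exact: measurable_coord. Qed.

End sequence_space.

Section iid.
Context d d' (T : measurableType d) (S : measurableType d') (R : realType).
Variable P : probability T R.

(** Independence and equality of the laws are packed into one product formula over
    initial segments; taking some B i to be the full set gives back any
    finite subfamily. *)
Definition iid (Y : nat -> T -> S) :=
  (forall n, measurable_fun setT (Y n)) /\
  forall n (B : nat -> set S), (forall i, measurable (B i)) ->
    P [set w | forall i, (i < n)%N -> B i (Y i w)] =
    (\prod_(i < n) P (Y 0%N @^-1` B i))%E.

Variable Y : nat -> T -> S.
Hypothesis iidY : iid Y.

Definition sample_path (w : T) : seq_space S := fun n => Y n w.

Lemma measurable_sample_path : measurable_fun setT sample_path.
Proof. by apply: measurable_to_seq => i; exact: iidY.1. Qed.

Definition tail_path (w : T) : seq_space S := seq_shift (sample_path w).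

Lemma measurable_tail_path : measurable_fun setT tail_path.
Proof.
exact: (measurableT_comp (@measurable_seq_shift _ S) measurable_sample_path).
Qed.

(** The second factor involves the whole path instead of its tail: this
    states at once that the tail is independent of the head and that it has the
    law of the full path.  On cylinders it is the product formula for one
    more coordinate, and a Dynkin class argument does the rest. *)
Lemma indep_head_tail B A : measurable B -> measurable (A : set (seq_space S)) ->
  P ((Y 0%N @^-1` B) `&` (tail_path @^-1` A)) =
  (P (Y 0%N @^-1` B) * P (sample_path @^-1` A))%E.
Proof.
move=> mB; move: A; have mY0B : measurable (Y 0%N @^-1` B).
  by rewrite -[X in measurable X]setTI; exact: iidY.1.
have mt A : measurable (A : set (seq_space S)) ->
    measurable (tail_path @^-1` A).
  by move=> mA; rewrite -[X in measurable X]setTI; exact: measurable_tail_path.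
have mp A : measurable (A : set (seq_space S)) -> measurable (sample_path @^-1` A).
  by move=> mA; rewrite -[X in measurable X]setTI; exact: measurable_sample_path.
apply: (@dynkin_induction _ (seq_space S) (@cylinders _ S)) => //.
- exact: setI_closed_cylinders.
- by rewrite !preimage_setT setIT probability_setT mule1.
- move=> _ [n [C [mC ->]]].
  have := iidY.2 n.+1 (fun i => if i is j.+1 then C j else B).
  rewrite big_ord_recl/= => H.
  transitivity (P [set w | forall i, (i < n.+1)%N ->
      (if i is j.+1 then C j else B) (Y i w)]).
    congr (P _); apply/seteqP; split => w /=.
      by move=> [Bw Cw] [|i]//; exact: Cw.
    by move=> h; split; [exact: (h 0%N)|move=> i ni; exact: (h i.+1)].
  rewrite H; last by case.
  by congr (_ * _)%E; rewrite -(iidY.2 n C).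
- move=> A mA IH.
  have -> : Y 0%N @^-1` B `&` tail_path @^-1` (~` A) =
      Y 0%N @^-1` B `\` tail_path @^-1` A by rewrite setDE.
  have -> : sample_path @^-1` (~` A) = ~` (sample_path @^-1` A) by [].
  have mA' := mp _ mA.
  have fA : P (sample_path @^-1` A) \is a fin_num by rewrite fin_num_measure.
  have fB : P (Y 0%N @^-1` B) \is a fin_num by rewrite fin_num_measure.
  rewrite measureD//; [|exact: mt|by rewrite ltey_eq fB].
  transitivity (P (Y 0%N @^-1` B) -
      P (Y 0%N @^-1` B) * P (sample_path @^-1` A))%E; first by congr (_ - _)%E.
  by rewrite probability_setC// muleBr ?mule1.
- move=> F mF tF IH.
  have tP (f : T -> seq_space S) : trivIset setT (fun n => f @^-1` F n).
    by apply/trivIsetP => i j _ _ ij; rewrite -preimage_setI;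
      move/trivIsetP : tF => ->//; rewrite preimage_set0.
  transitivity (\sum_(n <oo) P (Y 0%N @^-1` B `&` tail_path @^-1` F n))%E.
    rewrite preimage_bigcup setI_bigcupr measure_bigcup//.
    - by apply: eq_eseriesl => n; rewrite in_setT.
    - by move=> n _; apply: measurableI => //; exact: mt.
    - exact/trivIset_setIl/tP.
  rewrite preimage_bigcup measure_bigcup//; last by move=> n _; exact: mp.
  rewrite (eq_eseriesr (fun n _ => IH n)) -(@fineK _ (P (Y 0%N @^-1` B)));
    last by rewrite fin_num_measure.
  rewrite nneseriesZl//.
  by congr (_ * _)%E; apply: eq_eseriesl => n; rewrite in_setT.
Qed.

End iid.

(** * Integration over an independent event *)

Section independent_integral.
Context d (T : measurableType d) (R : realType) (P : probability T R).
Local Open Scope ereal_scope.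

(** Independence says that the law of V under P restricted to E is P(E) times the
    law of V under P; the identity is then a change of variables. *)
Lemma ge0_integral_indep d' (U : measurableType d') (V : T -> U) (f : U -> \bar R)
    (E : set T) :
  measurable_fun setT V -> measurable_fun setT f -> (forall u, 0 <= f u) ->
  measurable E ->
  (forall B, measurable B -> P (V @^-1` B `&` E) = P (V @^-1` B) * P E) ->
  \int[P]_(w in E) f (V w) = P E * \int[P]_w f (V w).
Proof.
move=> mV mf f0 mE indep.
have mfV : measurable_fun setT (f \o V) by exact: measurableT_comp.
have PE : (0 <= fine (P E))%R by rewrite fine_ge0.
pose Q := mrestr P mE.
have -> : \int[P]_(w in E) f (V w) = \int[Q]_(w in E) f (V w).
  apply: eq_measure_integral => A mA AE.
  by rewrite /Q/= /mrestr setIidl.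
have -> : \int[Q]_(w in E) f (V w) = \int[Q]_w f (V w).
  rewrite -[in RHS](setUv E) ge0_integral_setU//=.
  - rewrite [X in _ = _ + X]null_set_integral ?adde0//.
    + exact: measurableC.
    + exact: measurable_funTS.
    + by rewrite /Q/= /mrestr setICl measure0.
  - exact: measurableC.
  - exact: measurable_funTS.
  - exact/disj_setPCl.
have <- := @ge0_integral_pushforward _ _ _ _ _ V mV Q setT f measurableT mf
  (fun u _ => f0 u).
have <- := @ge0_integral_pushforward _ _ _ _ _ V mV P setT f measurableT mf
  (fun u _ => f0 u).
rewrite -[X in X * _]fineK ?fin_num_measure//.
rewrite -[X in X%:E * _]/((NngNum PE)%:num) -ge0_integral_mscale//.
apply: eq_measure_integral => B mB _.
rewrite /= /mscale/= /pushforward /Q/= /mrestr indep//.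
by rewrite fineK ?fin_num_measure// muleC.
Qed.

Lemma integral_indep (V : T -> R) (E : set T) :
  measurable_fun setT V -> measurable E ->
  (forall B, measurable B -> P (V @^-1` B `&` E) = P (V @^-1` B) * P E) ->
  P.-integrable setT (EFin \o V) ->
  \int[P]_(w in E) (V w)%:E = P E * \int[P]_w (V w)%:E.
Proof.
move=> mV mE indep iV.
rewrite [in LHS]integralE [in RHS]integralE.
rewrite -[fun w => (V w)%:E]/(EFin \o V) funepos_comp funeneg_comp/=.
have pos : measurable_fun [set: R] ((EFin : R -> \bar R)^\+).
  by apply: measurable_funepos; exact: EFin_measurable.
have neg : measurable_fun [set: R] ((EFin : R -> \bar R)^\-).
  by apply: measurable_funeneg; exact: EFin_measurable.
rewrite (ge0_integral_indep mV pos _ mE indep)//.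
rewrite (ge0_integral_indep mV neg _ mE indep)//.
rewrite [RHS]muleBr// ?fin_num_measure//.
apply: fin_num_adde_defr.
have := integrable_pos_fin_num measurableT iV.
by rewrite funepos_comp.
Qed.

End independent_integral.

(** * Sums with negative drift are bounded above *)

Section lindley.
Context (R : realType).

Implicit Types x : seq_space R.

(** This is the maximum of 0 and the first n partial sums, in the recursive form
    that a shift of the sequence respects. *)
Fixpoint lindley n x : R :=
  if n is m.+1 then Num.max 0 (x 0%N + lindley m (seq_shift x)) else 0.

Lemma lindley_ge0 n x : 0 <= lindley n x.
Proof. by case: n => //= n; rewrite le_max lexx. Qed.

Lemma lindley_leS n x : lindley n x <= lindley n.+1 x.
Proof.
elim: n x => [|n IH] x; first exact: lindley_ge0.
rewrite /= ge_max !le_max lexx/=; apply/orP; right.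
by rewrite lerD2l; exact: IH.
Qed.

Lemma lindley_nondecreasing x : {homo lindley^~ x : m n / (m <= n)%N >-> m <= n}.
Proof. by apply/nondecreasing_seqP => n; exact: lindley_leS. Qed.

Lemma sum_le_lindley n x : \sum_(i < n) x i <= lindley n x.
Proof.
elim: n x => [|n IH] x; first by rewrite big_ord0.
by rewrite big_ord_recl /= le_max lerD2l (IH (seq_shift x)) orbT.
Qed.

Definition lindley_unbounded : set (seq_space R) :=
  [set x | forall K : nat, exists n, K%:R < lindley n x].

(** M_(n+1) and M_n of the shifted sequence differ by at most the absolute value
    of the first term, whence the invariance of the event. *)
Lemma lindley_unbounded_shift x :
  lindley_unbounded (seq_shift x) <-> lindley_unbounded x.
Proof.
split=> ux K.
  have [n Kn] := ux (K + (Num.truncn `|x 0%N|).+1)%N.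
  exists n.+1; rewrite /= lt_max; apply/orP; right.
  have := truncnS_gt `|x 0%N|; have := ler_norm (- x 0%N); rewrite normrN.
  by move: Kn; rewrite natrD; lra.
have [[|n] Kn] := ux (K + (Num.truncn `|x 0%N|).+1)%N.
  by move: Kn; rewrite /= ltNge ler0n.
exists n; move: Kn; rewrite /= lt_max ltNge ler0n/=.
have := truncnS_gt `|x 0%N|; have := ler_norm (x 0%N).
by rewrite natrD; lra.
Qed.

Lemma measurable_lindley n : measurable_fun setT (lindley n).
Proof.
elim: n => [|n IH]; first exact: measurable_cst.
apply: measurable_maxr; first exact: measurable_cst.
apply: measurable_funD; first exact: measurable_coord.
exact: measurableT_comp IH (@measurable_seq_shift _ R).
Qed.

Lemma measurable_lindley_unbounded : measurable lindley_unbounded.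
Proof.
rewrite (_ : lindley_unbounded = \bigcap_(K in setT) \bigcup_(n in setT)
    (lindley n @^-1` `]K%:R, +oo[)).
  apply: bigcapT_measurable => K; apply: bigcup_measurable => n _.
  by rewrite -[X in measurable X]setTI; exact: measurable_lindley.
apply/seteqP; split => x /=.
  by move=> ux K _; have [n Kn] := ux K; exists n => //=; rewrite in_itv/= Kn.
move=> ux K; have [//|n _ /=] := ux K; rewrite in_itv/= andbT => Kn.
by exists n.
Qed.

End lindley.

Section negative_drift.
Context d (T : measurableType d) (R : realType) (P : probability T R).
Variable Y : nat -> T -> R.
Hypothesis iidY : iid P Y.
Local Open Scope ereal_scope.

(** The tail has the law of the path: this is [indep_head_tail] with the full
    space as head event. *)
Lemma ge0_integral_stationary (f : seq_space R -> \bar R) (A : set (seq_space R)) :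
  measurable_fun setT f -> (forall x, 0 <= f x) -> measurable A ->
  \int[P]_(w in tail_path Y @^-1` A) f (tail_path Y w) =
  \int[P]_(w in sample_path Y @^-1` A) f (sample_path Y w).
Proof.
move=> mf f0 mA.
have Ht := @ge0_integral_pushforward _ _ _ _ _ (tail_path Y)
  (measurable_tail_path iidY) P A f mA (measurable_funTS mf) (fun u _ => f0 u).
have Hp := @ge0_integral_pushforward _ _ _ _ _ (sample_path Y)
  (measurable_sample_path iidY) P A f mA (measurable_funTS mf) (fun u _ => f0 u).
rewrite -[LHS]Ht -[RHS]Hp {Ht Hp}.
apply: eq_measure_integral.
- exact: (measurable_sample_path iidY).
- exact: (measurable_tail_path iidY).
move=> mp mt B mB _.
have := indep_head_tail iidY measurableT mB.
by rewrite preimage_setT setTI probability_setT mul1e.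
Qed.

Let E := sample_path Y @^-1` @lindley_unbounded R.

Let tailE : tail_path Y @^-1` @lindley_unbounded R = E.
Proof.
apply/seteqP; split => w /= Ew.
  by apply/lindley_unbounded_shift.
by apply: (lindley_unbounded_shift _).2.
Qed.

Let mE : measurable E.
Proof.
rewrite -[X in measurable X]setTI; apply: (measurable_sample_path iidY) => //.
exact: measurable_lindley_unbounded.
Qed.

Hypothesis iY : P.-integrable setT (EFin \o Y 0%N).

Let mpath n : measurable_fun setT (fun w => lindley n (sample_path Y w)).
Proof.
exact: measurableT_comp (@measurable_lindley R n) (measurable_sample_path iidY).
Qed.

Let mtail n : measurable_fun setT (fun w => lindley n (tail_path Y w)).
Proof.
exact: measurableT_comp (@measurable_lindley R n) (measurable_tail_path iidY).
Qed.

Let stat n : \int[P]_(w in E) (lindley n (tail_path Y w))%:E =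
  \int[P]_(w in E) (lindley n (sample_path Y w))%:E.
Proof.
rewrite -[in LHS]tailE.
apply: (@ge0_integral_stationary (fun x => (lindley n x)%:E)).
- by apply/measurable_EFinP; exact: measurable_lindley.
- by move=> x; rewrite lee_fin lindley_ge0.
- exact: measurable_lindley_unbounded.
Qed.

Let lindley_path n w :
  (lindley n.+1 (sample_path Y w) =
   Num.max 0 (Y 0%N w + lindley n (tail_path Y w)))%R.
Proof. by []. Qed.

Let iYE : P.-integrable E (EFin \o Y 0%N).
Proof. exact: integrableS iY. Qed.

Let int_path n : P.-integrable E (fun w => (lindley n (sample_path Y w))%:E).
Proof.
apply/integrableP; split; first exact/measurable_EFinP/measurable_funTS/mpath.
have absE n' : \int[P]_(w in E) `|(lindley n' (sample_path Y w))%:E| =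
    \int[P]_(w in E) (lindley n' (sample_path Y w))%:E.
  by apply: eq_integral => w _; rewrite gee0_abs// lee_fin lindley_ge0.
rewrite absE; elim: n => [|n IH]; first by rewrite integral0 ltry.
apply: (@le_lt_trans _ _ (\int[P]_(w in E)
    (`|(Y 0%N w)%:E| + (lindley n (tail_path Y w))%:E))).
  apply: ge0_le_integral => //.
  - by move=> w _; rewrite lee_fin lindley_ge0.
  - exact/measurable_EFinP/measurable_funTS/mpath.
  - apply: measurable_funTS; apply: emeasurable_funD.
      by apply: measurableT_comp => //; exact/measurable_EFinP/iidY.1.
    exact/measurable_EFinP/mtail.
  - move=> w _; rewrite lindley_path -EFinD lee_fin ge_max.
    by rewrite addr_ge0 ?lindley_ge0//= lerD2r ler_norm.
rewrite ge0_integralD//=; last 3 first.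
- by apply/measurable_EFinP/measurable_funTS/measurableT_comp => //; exact: iidY.1.
- by move=> w _; rewrite lee_fin lindley_ge0.
- exact/measurable_EFinP/measurable_funTS/mtail.
rewrite stat; apply: lte_add_pinfty => //.
by have /integrableP[] := iYE.
Qed.

Let int_tail n : P.-integrable E (fun w => (lindley n (tail_path Y w))%:E).
Proof.
apply/integrableP; split; first exact/measurable_EFinP/measurable_funTS/mtail.
have /integrableP[_] := int_path n.
under eq_integral do rewrite gee0_abs ?lee_fin ?lindley_ge0//.
rewrite -stat.
by under [in X in _ -> X]eq_integral do rewrite gee0_abs ?lee_fin ?lindley_ge0//.
Qed.

(* This equals max(- M'_n, Y_0), whence the domination by |Y_0| and the limit
   Y_0 where M'_n is unbounded. *)
Let incr n w := (lindley n.+1 (sample_path Y w) - lindley n (tail_path Y w))%R.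

Let integral_incr_ge0 n : 0 <= \int[P]_(w in E) (incr n w)%:E.
Proof.
under eq_integral do rewrite EFinB.
rewrite integralB_EFin//; [|exact: int_path|exact: int_tail].
rewrite stat sube_ge0; last first.
  by rewrite (integrable_fin_num _ (int_path n)).
apply: ge0_le_integral => //.
- by move=> w _; rewrite lee_fin lindley_ge0.
- exact/measurable_EFinP/measurable_funTS/mpath.
- exact/measurable_EFinP/measurable_funTS/mpath.
- by move=> w _; rewrite lee_fin lindley_leS.
Qed.

Let incr_le n w : (`|incr n w| <= `|Y 0%N w|)%R.
Proof.
rewrite /incr lindley_path.
have := lindley_ge0 n (tail_path Y w); move: (lindley _ _) => l l0.
by rewrite maxEle; case: (leP 0%R (Y 0%N w + l)%R) => h;
  rewrite ler_norml; apply/andP; split;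
  case: (ger0P (Y 0%N w)) => ?; lra.
Qed.

Let incr_cvg w : E w -> (incr n w)%:E @[n --> \oo] --> (Y 0%N w)%:E.
Proof.
rewrite -tailE => Ew; apply: cvg_near_cst.
have [n0 hn0] := Ew (Num.truncn `|Y 0%N w|).+1.
exists n0 => // n /= n0n; rewrite /incr lindley_path; congr EFin.
have := lindley_nondecreasing (tail_path Y w) n0n.
have := truncnS_gt `|Y 0%N w|; have := ler_norm (- Y 0%N w); rewrite normrN.
move: hn0 => /=; move: (lindley n _) => l; rewrite maxEle.
by case: (leP 0%R (Y 0%N w + l)%R) => //; lra.
Qed.

(** The maximal inequality: the increments have nonnegative integral over E by
    stationarity, and converge to Y_0 there by dominated convergence. *)
Lemma integral_unbounded_ge0 : 0 <= \int[P]_(w in E) (Y 0%N w)%:E.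
Proof.
have mincr n : measurable_fun E (fun w => (incr n w)%:E).
  apply/measurable_EFinP/measurable_funTS.
  by apply: measurable_funB; [exact: mpath|exact: mtail].
have mY : measurable_fun E (EFin \o Y 0%N).
  exact/measurable_EFinP/measurable_funTS/iidY.1.
have incrE : {ae P, forall w, E w ->
    (incr n w)%:E @[n --> \oo] --> (EFin \o Y 0%N) w}.
  by apply: aeW => w; exact: incr_cvg.
have dom : {ae P, forall w n, E w -> `|(incr n w)%:E| <= `|(EFin \o Y 0%N) w|}.
  by apply: aeW => w n _; rewrite lee_fin incr_le.
have [_ _ cv] := dominated_convergence mE mincr mY incrE (integrable_abse iYE) dom.
by apply: (cvge_ge _ cv) => //; apply: nearW.
Qed.

(** E is independent of Y_0, so the previous bound reads 0 <= P(E) E(Y_0). *)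
Lemma negative_drift_bounded : \int[P]_w (Y 0%N w)%:E < 0 ->
  {ae P, forall w, exists C, forall n, (\sum_(i < n) Y i w <= C)%R}.
Proof.
move=> Y0; exists E; split; first exact: mE.
- have := integral_unbounded_ge0.
  rewrite (integral_indep (iidY.1 0%N) mE) => //; last first.
    move=> B mB; have := indep_head_tail iidY mB (@measurable_lindley_unbounded R).
    by rewrite tailE.
  move=> h; apply/eqP; rewrite eq_le measure_ge0 andbT leNgt; apply/negP => PE.
  by move: h; rewrite leNgt => /negP; apply; rewrite pmule_rlt0.
- move=> w; apply: contra_notP => /= nEw.
  have [K hK] : exists K : nat, forall n, (lindley n (sample_path Y w) <= K%:R)%R.
    apply: contra_notP nEw => h K; apply: contra_notP h => h.
    exists K => n; rewrite leNgt; apply/negP => hn.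
    by apply: h; exists n.
  exists K%:R => n; exact: le_trans (sum_le_lindley n _) (hK n).
Qed.

End negative_drift.

(** * The strong law and the Borel-Cantelli lemmas *)

Section strong_law.
Context d (T : measurableType d) (R : realType) (P : probability T R).

Lemma iid_comp d1 d2 (S : measurableType d1) (S' : measurableType d2)
    (g : S -> S') (Y : nat -> T -> S) :
  measurable_fun setT g -> iid P Y -> iid P (fun n => g \o Y n).
Proof.
move=> mg [mY iY]; split=> [n|n B mB]; first exact: measurableT_comp.
apply: (iY n (fun i => g @^-1` B i)) => i.
by rewrite -[X in measurable X]setTI; exact: mg.
Qed.

Lemma iid_identically_distributed d1 (S : measurableType d1)
    (Y : nat -> T -> S) n B :
  iid P Y -> measurable B -> P (Y n @^-1` B) = P (Y 0%N @^-1` B).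
Proof.
move=> [mY iY] mB.
have := iY n.+1 (fun i => if i == n then B else setT).
rewrite big_ord_recr/= eqxx big1 ?mul1e => [H|i _]; last first.
  by rewrite ltn_eqF// preimage_setT probability_setT.
rewrite -H => [|i]; last by case: ifP.
congr (P _); apply/seteqP; split => w /=.
  by move=> Bw i _; case: eqP => // ->.
by move=> /(_ n (ltnSn n)); rewrite eqxx.
Qed.

Section real_valued.
Variables (Y : nat -> T -> R) (m : R).
Hypothesis iidY : iid P Y.
Hypothesis iY : P.-integrable setT (EFin \o Y 0%N).
Hypothesis EY : (\int[P]_w (Y 0%N w)%:E = m%:E)%E.

(** Subtracting m + e from each term makes the drift equal to - e. *)
Lemma sum_le_linear (e : R) : 0 < e ->
  {ae P, forall w, exists C, forall n, \sum_(i < n) Y i w <= C + (m + e) * n%:R}.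
Proof.
move=> e0; pose c := m + e.
have mg : measurable_fun [set: R] (fun x : R => x - c).
  by apply: measurable_funB => //; exact: measurable_cst.
have iid' := iid_comp mg iidY.
have icst : P.-integrable setT (EFin \o cst c).
  exact: finite_measure_integrable_cst.
have iY' : P.-integrable setT (EFin \o ((fun x : R => x - c) \o Y 0%N)).
  rewrite (_ : _ \o _ = (EFin \o Y 0%N) \- (EFin \o cst c))%E//.
  exact: integrableB.
have EY' : (\int[P]_w (((fun x : R => x - c) \o Y 0%N) w)%:E < 0)%E.
  under eq_integral do rewrite /= EFinB.
  rewrite integralB_EFin// EY integral_cst//.
  rewrite [X in (_ * X)%E](probability_setT P) mule1 -EFinB lte_fin.
  by rewrite /c; lra.
apply: filterS (negative_drift_bounded iid' iY' EY') => w [C hC].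
exists C => n; have := hC n.
by rewrite /= big_split/= sumr_const card_ord mulNrn -[_ *+ n]mulr_natr /c; lra.
Qed.

End real_valued.

(** An equivalent of the convergence of S_n / n to m that can be inserted as it is
    in the pathwise estimates. *)
Lemma strong_law_linear (Y : nat -> T -> R) (m : R) :
  iid P Y -> P.-integrable setT (EFin \o Y 0%N) ->
  (\int[P]_w (Y 0%N w)%:E = m%:E)%E ->
  {ae P, forall w, forall e, 0 < e ->
     exists C, forall n, `|\sum_(i < n) Y i w - m * n%:R| <= C + e * n%:R}.
Proof.
move=> iidY iY EY.
have mN : measurable_fun [set: R] (-%R : R -> R) by exact: measurable_funN.
have iidN := iid_comp mN iidY.
have iN : P.-integrable setT (EFin \o (-%R \o Y 0%N)).
  by rewrite (_ : _ \o _ = \- (EFin \o Y 0%N))%E//; exact: integrableN.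
have EN : (\int[P]_w ((-%R \o Y 0%N) w)%:E = (- m)%:E)%E.
  under eq_integral do rewrite /= EFinN.
  by rewrite integralN ?EY//; exact: integrable_add_def.
have key : {ae P, forall w, forall k : nat,
    exists C, forall n, `|\sum_(i < n) Y i w - m * n%:R| <= C + k.+1%:R^-1 * n%:R}.
  apply: ae_foralln => k; have k0 : 0 < k.+1%:R^-1 :> R by rewrite invr_gt0.
  apply: filterS2 (sum_le_linear iidY iY EY k0) (sum_le_linear iidN iN EN k0).
  move=> w [C hC] [C' hC']; exists (Num.max C C') => n.
  have := hC n; have := hC' n; rewrite /= sumrN.
  have : C <= Num.max C C' by rewrite le_max lexx.
  have : C' <= Num.max C C' by rewrite le_max lexx orbT.
  move: (k.+1%:R^-1) => e; move: (Num.max _ _) => M.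
  by rewrite ler_norml => ? ? ? ?; apply/andP; split; lra.
apply: filterS key => w h e e0.
have [C hC] := h (Num.truncn e^-1).
exists C => n; apply: le_trans (hC n) _.
rewrite lerD2l ler_wpM2r// invf_ple ?posrE//.
exact/ltW/truncnS_gt.
Qed.

End strong_law.

Section borel_cantelli.
Context d d' (T : measurableType d) (S : measurableType d') (R : realType).
Variables (P : probability T R) (Y : nat -> T -> S).
Hypothesis iidY : iid P Y.
Variable C : nat -> set S.
Hypothesis mC : forall n, measurable (C n).

Let p n : R := fine (P (Y 0%N @^-1` C n)).

Let mYC n B : measurable B -> measurable (Y n @^-1` B).
Proof. by move=> mB; rewrite -[X in measurable X]setTI; exact: iidY.1. Qed.

(** A rational substitute for the bound prod (1 - q_i) <= exp (- sum q_i): it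
    suffices to make the product vanish when the sum diverges. *)
Lemma prod_compl_le (q : nat -> R) n : (forall i, 0 <= q i <= 1) ->
  \prod_(i < n) (1 - q i) * (1 + \sum_(i < n) q i) <= 1.
Proof.
move=> q01; elim: n => [|n IH]; first by rewrite !big_ord0; lra.
rewrite !big_ord_recr/=; apply: le_trans IH.
have p0 : 0 <= \prod_(i < n) (1 - q i).
  by apply: prodr_ge0 => i _; have /andP[_] := q01 i; lra.
have s0 : 0 <= \sum_(i < n) q i by apply: sumr_ge0 => i _; have /andP[] := q01 i.
rewrite -mulrA ler_wpM2l//; have /andP[] := q01 n; nra.
Qed.

(** By independence P(N) is at most the product of the 1 - p_i over m <= i < n,
    where N is the event that C n never occurs from index m on; hence
    P(N) (1 + sum p_i) <= 1 for every n, and P(N) = 0. *)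
Lemma borel_cantelli2 :
  (forall K : R, exists n, K <= \sum_(i < n) p i) ->
  {ae P, forall w, forall m, exists2 n, (m <= n)%N & C n (Y n w)}.
Proof.
move=> dv; apply: ae_foralln => m.
pose B n := if (n < m)%N then setT else ~` C n.
pose N := \bigcap_n (Y n @^-1` B n).
have mB n : measurable (B n) by rewrite /B; case: ifP => // _; exact: measurableC.
have mN : measurable N by apply: bigcapT_measurable => n; exact: mYC.
exists N; split => //.
- pose q n := if (n < m)%N then 0 else p n.
  have p01 n : 0 <= p n <= 1.
    rewrite fine_ge0//= -lee_fin fineK ?fin_num_measure//; [|exact: mYC].
    exact: probability_le1 (mYC _ (mC n)).
  have q01 n : 0 <= q n <= 1 by rewrite /q; case: ifP => //; rewrite lexx ler01.
  have PB n : P (Y 0%N @^-1` B n) = (1 - q n)%:E.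
    rewrite /B /q; case: ifP => _.
      by rewrite preimage_setT probability_setT subr0.
    rewrite preimage_setC probability_setC; last exact: mYC.
    by rewrite EFinB fineK// fin_num_measure//; exact: mYC.
  have PN n : (P N <= (\prod_(i < n) (1 - q i))%:E)%E.
    apply: (@le_trans _ _ (P [set w | forall i, (i < n)%N -> B i (Y i w)])).
      apply: le_measure; rewrite ?inE//.
        rewrite (_ : [set w | _] = \bigcap_(i in `I_n) (Y i @^-1` B i)).
          by apply: bigcap_measurableType => i _; exact: mYC.
        by apply/seteqP; split => w.
      by move=> w Nw i _; exact: Nw.
    rewrite iidY.2//; under eq_bigr do rewrite PB.
    by rewrite prodEFin.
  have fN : P N \is a fin_num by rewrite fin_num_measure.
  apply: (eq_trans (esym (fineK fN))); congr EFin.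
  have N0 : 0 <= fine (P N) by rewrite fine_ge0.
  apply/eqP; rewrite eq_le N0 andbT leNgt; apply/negP => Npos.
  have [n hn] := dv (m%:R + (fine (P N))^-1).
  have hq : (fine (P N))^-1 <= \sum_(i < n) q i.
    have : \sum_(i < n) p i <= m%:R + \sum_(i < n) q i.
      apply: (@le_trans _ _ (\sum_(i < n) ((i < m)%N%:R + q i))).
        apply: ler_sum => i _; rewrite /q; case: ifP => _; last by rewrite add0r.
        by rewrite addr0; have /andP[] := p01 i.
      rewrite big_split/= lerD2r -natr_sum ler_nat.
      elim: (n) => [|k IH]; first by rewrite big_ord0.
      rewrite big_ord_recr/=; case: (ltnP k m) => [km|_]; last by rewrite addn0.
      rewrite addn1 (leq_ltn_trans _ km)//.
      rewrite -[leqRHS]card_ord -sum1_card leq_sum// => i _.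
      by case: (_ < _)%N.
    by move: hn; lra.
  have PN' : fine (P N) <= \prod_(i < n) (1 - q i).
    by rewrite -lee_fin fineK//; exact: PN.
  have := prod_compl_le n q01; apply/negP; rewrite -ltNge.
  have S0 : 0 < (fine (P N))^-1 by rewrite invr_gt0.
  apply: (@lt_le_trans _ _ (fine (P N) * (1 + (fine (P N))^-1))).
    by rewrite mulrDr mulr1 mulfV ?lt0r_neq0//; lra.
  by apply: ler_pM => //; lra.
- move=> w /=; apply: contra_notP => nN; apply: contra_notP nN => h n _ /=.
  rewrite /B; case: ltnP => // mn; move=> Cn; apply: h; by exists n.
Qed.

Lemma borel_cantelli1 (K : R) : (forall n, \sum_(i < n) p i <= K) ->
  {ae P, forall w, exists m, forall n, (m <= n)%N -> ~ C n (Y n w)}.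
Proof.
move=> hK; pose F n := Y n @^-1` C n.
have mF n : measurable (F n) by exact: mYC.
exists (lim_sup_set F); split.
- by apply: bigcapT_measurable => n; apply: bigcup_measurable.
- apply: lim_sup_set_cvg0 => //.
  apply: (@le_lt_trans _ _ K%:E); last exact: ltry.
  apply: lime_le; first exact: is_cvg_nneseries.
  apply: nearW => n; rewrite big_mkord.
  rewrite (eq_bigr (fun i : 'I_n => (p i)%:E)%E) => [|i _].
    by rewrite sumEFin lee_fin; exact: hK.
  rewrite /p fineK ?fin_num_measure//; last exact: mYC.
  exact: iid_identically_distributed.
- move=> w /= h n _; apply: contrapT => h'; apply: h.
  by exists n => k nk Ck; apply: h'; exists k.
Qed.

End borel_cantelli.

(** * Linear estimates along one trajectory *)

Section deterministic.
Context d (T : measurableType d) (R : realType).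
Variables (X : nat -> T -> R * R) (w : T).

Let S n := random_walk X n w.
Let V n := (X n.+1 w).2.
Let hits (t : R) n : R := \sum_(i < n) (S i + V i <= t)%R%:R.

Let visits_partial t n :
  (\sum_(1 <= i < n.+1) ((perturbed_walk X i w <= t)%R%:R : R)%:E)%E =
  (hits t n)%:E.
Proof. by rewrite big_add1/= sumEFin big_mkord. Qed.

Lemma hits_le_visits t n : ((hits t n)%:E <= visits X t w)%E.
Proof. by rewrite -visits_partial; apply: nneseries_lim_ge => i _ _. Qed.

Lemma visits_le t (M : \bar R) : (forall n, (hits t n)%:E <= M)%E ->
  (visits X t w <= M)%E.
Proof.
move=> hM; apply: lime_le; first exact: is_cvg_nneseries.
apply: nearW => -[|n]; last by rewrite visits_partial.
by rewrite big_geq//; have := hM 0%N; rewrite /hits big_ord0.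
Qed.

Lemma last_exit_ge0 t : (0 <= last_exit X t w)%E.
Proof. by apply: ereal_sup_ubound; left. Qed.

(** The j visits counted up to some index occur at distinct positive indices, so
    the last of them has index at least j. *)
Lemma visits_le_last_exit t : (visits X t w <= last_exit X t w)%E.
Proof.
apply: visits_le => n.
have [j jn [hj Hj]] : exists2 j, (j <= n)%N & hits t n <= j%:R /\
    (j%:R%:E <= last_exit X t w)%E.
  elim: n => [|n [j jn [hj Hj]]].
    by exists 0%N => //; split; [rewrite /hits big_ord0|exact: last_exit_ge0].
  rewrite {1}/hits big_ord_recr/= -/(hits t n); case: leP => hT.
    exists n.+1 => //; split; first by rewrite -natr1 lerD2r (le_trans hj)// ler_nat.
    by apply: ereal_sup_ubound; right; exists n.+1.
  by exists j; [exact: leqW|split => //; rewrite addr0].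
by apply: le_trans Hj; rewrite lee_fin.
Qed.

Lemma visits_infinite t :
  (forall m, exists2 n, (m <= n)%N & S n + V n <= t) -> visits X t w = +oo%E.
Proof.
move=> io; apply/eqyP => A A0.
have [n hn] : exists n, (Num.truncn A).+1%:R <= hits t n.
  elim: (Num.truncn A).+1 => [|k [n hn]].
    by exists 0%N; rewrite /hits big_ord0.
  have [n' nn' Tn'] := io n; exists n'.+1.
  rewrite /hits big_ord_recr/= -/(hits t n') Tn' -natr1 lerD2r (le_trans hn)//.
  by rewrite /hits -(subnKC nn') big_split_ord/= lerDl sumr_ge0.
apply: le_trans (hits_le_visits t n); rewrite lee_fin.
by apply: le_trans hn; exact/ltW/truncnS_gt.
Qed.

Lemma last_exit_le_linear (a C t : R) : 0 < a ->
  (forall n, a * n%:R - C <= S n + V n) ->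
  0 <= t + C ->
  (last_exit X t w <= ((t + C) / a + 1)%:E)%E.
Proof.
move=> a0 hT tC; apply: ge_ereal_sup => _ [->|[[|n] [// _ hn] <-]].
  by rewrite lee_fin addr_ge0// divr_ge0// ltW.
rewrite lee_fin -natr1 lerD2r ler_pdivlMr// mulrC.
by have := hT n; move: hn; rewrite /perturbed_walk/= -/(S n) -/(V n); lra.
Qed.

(** Up to the index m = (t - C - K) / a the walk S stays below t - K, so
    every i < m is a visit unless V i > K. *)
Lemma visits_ge_linear (a C K C' delta t : R) : 0 < a -> 0 <= delta <= 1 ->
  (forall n, S n <= C + a * n%:R) ->
  (forall n, \sum_(i < n) (K < V i)%R%:R <= C' + delta * n%:R) ->
  C + K <= t ->
  ((((t - C - K) / a - 1) * (1 - delta) - C')%:E <= visits X t w)%E.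
Proof.
move=> a0 /andP[d0 d1] hS hV tCK.
pose x := (t - C - K) / a; pose m := Num.truncn x.
have x0 : 0 <= x by apply: divr_ge0; [lra|exact: ltW].
have mx : m%:R <= x by rewrite truncn_le.
apply: le_trans (hits_le_visits t m); rewrite lee_fin.
have xm : x - 1 <= m%:R by have := truncnS_gt x; rewrite -natr1; lra.
have hm : m%:R <= hits t m + \sum_(i < m) (K < V i)%R%:R.
  rewrite /hits -big_split/= -[X in X%:R <= _]card_ord -sum1_card natr_sum.
  apply: ler_sum => i _.
  case: (ltP K (V i)) => KV; first by rewrite lerDr ler0n.
  have iax : a * i%:R <= t - C - K.
    rewrite mulrC -ler_pdivlMr// (le_trans _ mx)// ler_nat; exact: ltnW.
  suff -> : S i + V i <= t by rewrite addr0.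
  by have := hS i; lra.
have := hV m; have : (x - 1) * (1 - delta) <= m%:R * (1 - delta).
  by rewrite ler_wpM2r//; lra.
by rewrite -/x; move: hm; move: (hits t m) (\sum_(i < m) _) => p q; lra.
Qed.

(** The hypothesis also makes f finite near infinity, so the quotient of extended
    reals is eventually a real quotient. *)
Lemma cvg_div_id (f : R -> \bar R) (l : R) :
  (forall e : R, 0 < e -> \forall t \near +oo%R,
     (((l - e) * t)%:E <= f t <= ((l + e) * t)%:E)%E) ->
  (f t / t%:E)%E @[t --> +oo%R] --> l%:E.
Proof.
move=> hf.
have fine_f : \forall t \near +oo%R, (fine (f t) / t)%:E = (f t / t%:E)%E.
  near=> t.
  have t0 : t != 0 by rewrite gt_eqF//; near: t; exact: nbhs_pinfty_gt.
  have /andP[h1 h2] : (((l - 1) * t)%:E <= f t <= ((l + 1) * t)%:E)%E.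
    by near: t; exact: hf.
  have ff : f t \is a fin_num.
    by rewrite fin_numElt (lt_le_trans _ h1) ?ltNyr//= (le_lt_trans h2)// ltry.
  by rewrite -[in RHS](fineK ff) inver (negbTE t0) -EFinM.
apply: (cvg_trans (near_eq_cvg fine_f)); apply: cvg_EFin; first exact: nearW.
apply/cvgrPdist_le => e e0; near=> t.
have t0 : 0 < t by near: t; exact: nbhs_pinfty_gt.
have /andP[h1 h2] : (((l - e) * t)%:E <= f t <= ((l + e) * t)%:E)%E.
  by near: t; exact: hf.
have ff : f t \is a fin_num.
  by rewrite fin_numElt (lt_le_trans _ h1) ?ltNyr//= (le_lt_trans h2)// ltry.
move: h1 h2; rewrite -(fineK ff) !lee_fin => h1 h2.
by rewrite distrC ler_distl ler_pdivlMr// ler_pdivrMr// h1.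
Unshelve. all: by end_near. Qed.

Variable mu : R.
Hypothesis mu0 : 0 < mu.
Hypothesis S_linear : forall e : R, 0 < e -> exists C : R, forall n,
  `|S n - mu * n%:R| <= C + e * n%:R.
Hypothesis V_lower : forall e : R, 0 < e -> exists C : R, forall n,
  - C - e * n%:R <= V n.
Hypothesis V_upper : forall delta : R, 0 < delta -> exists K C : R, forall n,
  \sum_(i < n) (K < V i)%R%:R <= C + delta * n%:R.

Lemma visits_lower (e : R) : 0 < e ->
  \forall t \near +oo%R, (((mu^-1 - e) * t)%:E <= visits X t w)%E.
Proof.
move=> e0; pose delta := Num.min (2^-1) (e * mu / 4).
have d0 : 0 < delta by rewrite lt_min invr_gt0 ltr0n/= divr_gt0// mulr_gt0.
have d1 : delta <= 2^-1 by rewrite ge_min lexx.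
have d2 : delta <= e * mu / 4 by rewrite ge_min lexx orbT.
have dmu : 0 < delta * mu by rewrite mulr_gt0.
have [C hC] := S_linear dmu; have [K [C' hV]] := V_upper d0.
(* The slope a leaves a margin delta mu above mu for the fluctuations of S. *)
pose a := mu * (1 + delta).
have a0 : 0 < a by rewrite mulr_gt0//; lra.
have hS n : S n <= C + a * n%:R.
  by have := hC n; rewrite ler_norml => /andP[_]; rewrite /a; lra.
(* (1 - 2 delta) (1 + delta) <= 1 - delta, and 2 delta / mu <= e / 2. *)
have rate : mu^-1 - e / 2 <= (1 - delta) / a.
  rewrite ler_pdivlMr// /a mulrA mulrBl mulVf ?lt0r_neq0//.
  by nra.
have d01 : 0 <= delta <= 1 by rewrite ltW//=; lra.
near=> t.
have tCK : C + K <= t by near: t; exact/nbhs_pinfty_ge/num_real.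
have t0 : 0 <= t by near: t; exact/nbhs_pinfty_ge/num_real.
apply: le_trans (visits_ge_linear a0 d01 hS hV tCK).
rewrite lee_fin.
have -> : ((t - C - K) / a - 1) * (1 - delta) - C' =
    t * ((1 - delta) / a) - ((C + K) * ((1 - delta) / a) + (1 - delta) + C').
  by ring.
have tD : ((C + K) * ((1 - delta) / a) + (1 - delta) + C') / (e / 2) <= t.
  by near: t; exact/nbhs_pinfty_ge/num_real.
move: tD; rewrite ler_pdivrMr ?divr_gt0// => tD.
have : t * (mu^-1 - e / 2) <= t * ((1 - delta) / a) by rewrite ler_wpM2l.
by move: tD; move: ((C + K) * _ + _ + C') (t * (_ / a)) => D x; lra.
Unshelve. all: by end_near. Qed.

Lemma last_exit_upper (e : R) : 0 < e ->
  \forall t \near +oo%R, (last_exit X t w <= ((mu^-1 + e) * t)%:E)%E.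
Proof.
move=> e0; (* 1 / a is halfway between 1 / mu and 1 / mu + e, and mu - a > 0 is shared
   between the fluctuations of S and those of V. *)
pose a := (mu^-1 + e / 2)^-1.
have mu'0 : 0 < mu^-1 by rewrite invr_gt0.
have ai0 : 0 < mu^-1 + e / 2 by rewrite addr_gt0// divr_gt0.
have a0 : 0 < a by rewrite invr_gt0.
have amu : a < mu by rewrite /a invf_plt ?posrE//; lra.
have e'0 : 0 < (mu - a) / 2 by rewrite divr_gt0// subr_gt0.
have [C hC] := S_linear e'0; have [C' hC'] := V_lower e'0.
have hT n : a * n%:R - (C + C') <= S n + V n.
  by have := hC n; have := hC' n; rewrite ler_norml => h1 /andP[h2 _]; lra.
near=> t.
have tC : 0 <= t + (C + C').
  by rewrite -lerBlDr sub0r; near: t; exact/nbhs_pinfty_ge/num_real.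
apply: le_trans (last_exit_le_linear a0 hT tC) _; rewrite lee_fin /a invrK.
have tD : ((C + C') * (mu^-1 + e / 2) + 1) / (e / 2) <= t.
  by near: t; exact/nbhs_pinfty_ge/num_real.
by move: tD; rewrite ler_pdivrMr ?divr_gt0//; lra.
Unshelve. all: by end_near. Qed.

Lemma visits_last_exit_cvg :
  ((visits X t w / t%:E)%E @[t --> +oo%R] --> (mu^-1)%:E) /\
  ((last_exit X t w / t%:E)%E @[t --> +oo%R] --> (mu^-1)%:E).
Proof.
split; apply: cvg_div_id => e e0; near=> t.
  apply/andP; split; first by near: t; exact: visits_lower.
  apply: (le_trans (visits_le_last_exit t)).
  by near: t; exact: last_exit_upper.
apply/andP; split; last by near: t; exact: last_exit_upper.
apply: le_trans (visits_le_last_exit t).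
by near: t; exact: visits_lower.
Unshelve. all: by end_near. Qed.

End deterministic.

(** * Almost sure estimates on the perturbation *)

Lemma iid_of_independent_copies d d' (T : measurableType d) (S : measurableType d')
    (R : realType) (P : probability T R) (X : nat -> {RV P >-> S})
    (X0 : {RV P >-> S}) :
  independent_copies X X0 -> iid P (fun n => X n.+1 : T -> S).
Proof.
move=> [indep same]; split=> [n|n B mB]; first exact: measurable_funP.
have law k : (1 <= k)%N -> forall C, measurable C ->
    P (X k @^-1` C) = P (X 1%N @^-1` C).
  by move=> k1 C mC; rewrite [LHS](same k k1 C mC) [RHS](same 1%N _ C mC).
(* The copies are indexed from 1, hence the sets B k.-1 at index k. *)
pose J := [fset i in iota 1 n]%fset.
have J1 : [set` J] `<=` [set k | (1 <= k)%N].
  by move=> k /=; rewrite !inE mem_iota => /andP[].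
have := indep J (fun k => B k.-1) J1 (fun j _ => mB j.-1).
rewrite (perm_big (iota 1 n)); last first.
  apply: uniq_perm; [exact: fset_uniq|exact: iota_uniq|].
  by move=> k; rewrite !inE.
rewrite (iotaDl 1 0 n : iota 1 n = _) big_map.
rewrite (_ : iota 0 n = index_iota 0 n); last by rewrite /index_iota subn0.
rewrite big_mkord => H.
transitivity (\prod_(i < n) P (X (1 + i)%N @^-1` B i))%E; last first.
  by apply: eq_bigr => i _; exact: law.
rewrite -[RHS]H; congr (P _); apply/seteqP; split => w /= hw.
  by move=> [|j] /=; rewrite !inE mem_iota// add1n ltnS => jn; exact: hw.
move=> i ni; apply: (hw i.+1) => /=.
by rewrite !inE mem_iota/= add1n ltnS.
Qed.

Section tail_comparison.
Context (R : realType).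

(** Comparison of a sum with the sum over blocks of length k, as in
    Cauchy condensation. *)
Lemma sum_le_block_sum (a b : nat -> R) k N :
  (forall n, b n <= a (n %/ k)%N) -> (0 < k)%N ->
  \sum_(n < k * N) b n <= k%:R * \sum_(j < N) a j.
Proof.
move=> ba k0; elim: N => [|N IH]; first by rewrite muln0 !big_ord0 mulr0.
rewrite mulnSr big_split_ord/= big_ord_recr/= mulrDr lerD//.
rewrite -[X in X%:R * _]card_ord mulr_natl -sumr_const ler_sum// => i _.
by apply: le_trans (ba _) _; rewrite mulnC divnMDl// divn_small// addn0.
Qed.

End tail_comparison.

Section negative_parts.
Context d (T : measurableType d) (R : realType) (P : probability T R).
Variable V : nat -> T -> R.
Hypothesis iidV : iid P V.

Let p c n : R := fine (P (V 0%N @^-1` [set v | v < - (c * n%:R)])).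

Let mlt (c : R) (n : nat) : measurable [set v : R | v < - (c * n%:R)].
Proof. by rewrite (_ : [set v | _] = `]-oo, - (c * n%:R)[%classic). Qed.

Let mV0 B : measurable B -> measurable (V 0%N @^-1` B).
Proof. by move=> mB; rewrite -[X in measurable X]setTI; exact: iidV.1. Qed.

(** Summability of P(V_0 < - c n) does not depend on c: for an integer k with
    e k >= c, each block of k consecutive terms of slope e is dominated by k
    times one term of slope c. *)
Lemma bounded_tail_sum (c e : R) : 0 < e ->
  (exists K, forall n, \sum_(i < n) p c i <= K) ->
  exists K, forall n, \sum_(i < n) p e i <= K.
Proof.
move=> e0 [K hK]; pose k := (Num.truncn (c / e)).+1.
have ck : c <= e * k%:R.
  by rewrite mulrC -ler_pdivrMr//; exact/ltW/truncnS_gt.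
have p0 c' n : 0 <= p c' n by rewrite fine_ge0.
exists (k%:R * K) => n.
apply: (@le_trans _ _ (\sum_(i < k * n) p e i)).
  rewrite -(subnKC (leq_pmull n (isT : (0 < k)%N))) big_split_ord/= lerDl.
  by apply: sumr_ge0.
apply: (@le_trans _ _ (k%:R * \sum_(i < n) p c i)); last by rewrite ler_wpM2l.
apply: sum_le_block_sum => // i.
have mc c' j : measurable (V 0%N @^-1` [set v | v < - (c' * j%:R)]) :=
  mV0 (mlt c' j).
apply: fine_le; rewrite ?fin_num_measure//.
apply: le_measure; [exact: mem_set (mc _ _)|exact: mem_set (mc _ _)|].
move=> w /= /lt_le_trans; apply; rewrite lerN2.
have : (i %/ k)%:R * k%:R <= i%:R :> R by rewrite -natrM ler_nat leq_trunc_div.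
have : 0 <= (i %/ k)%:R :> R by [].
by move: e0 ck; set a := _%:R; set b := _%:R; set c' := _%:R; nra.
Qed.

(** The two cases are the divergence and the convergence of the sum of the
    P(V_0 < - c n); in the second one, [bounded_tail_sum] passes from the
    slope c to every slope e > 0. *)
Lemma lower_bound_dichotomy (c : R) :
  {ae P, forall w, forall m, exists2 n, (m <= n)%N & V n w < - (c * n%:R)} \/
  {ae P, forall w, forall e, 0 < e -> exists C, forall n, - C - e * n%:R <= V n w}.
Proof.
have [[K hK]|nb] :=
  pselect (exists K, forall n, \sum_(i < n) p c i <= K); last first.
  left; apply: (borel_cantelli2 iidV (mlt c)) => K.
  apply: contrapT => h; apply: nb; exists K => n; rewrite leNgt; apply/negP => hn.
  by apply: h; exists n; exact: ltW.
right.
have key : {ae P, forall w (k : nat), exists m, forall n, (m <= n)%N ->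
    ~ (V n w < - (k.+1%:R^-1 * n%:R))}.
  apply: ae_foralln => k.
  have k0 : 0 < k.+1%:R^-1 :> R by rewrite invr_gt0.
  have [K' hK'] := bounded_tail_sum k0 (ex_intro _ K hK).
  exact: (borel_cantelli1 iidV (mlt k.+1%:R^-1) hK').
apply: filterS key => w h e e0.
have [m hm] := h (Num.truncn e^-1).
(* This constant absorbs the indices below m, where no bound is known. *)
exists (\sum_(i < m) `|V i w|) => n.
have s0 : 0 <= \sum_(i < m) `|V i w| by apply: sumr_ge0.
have [mn|nm] := leqP m n.
  have := hm n mn => /negP; rewrite -leNgt; apply: le_trans.
  have : (Num.truncn e^-1).+1%:R^-1 * n%:R <= e * n%:R.
    by rewrite ler_wpM2r// invf_ple ?posrE//; exact/ltW/truncnS_gt.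
  by move: (_.+1%:R^-1 * n%:R) => a; lra.
have : `|V n w| <= \sum_(i < m) `|V i w|.
  by rewrite (bigD1 (Ordinal nm))//= lerDl sumr_ge0.
have : 0 <= e * n%:R by rewrite mulr_ge0// ltW.
by have := ler_norm (- V n w); rewrite normrN; lra.
Qed.

End negative_parts.

Section exceedances.
Context d (T : measurableType d) (R : realType) (P : probability T R).
Variable V : nat -> T -> R.
Hypothesis iidV : iid P V.

Let mgt (K : R) : measurable [set v : R | K < v].
Proof.
rewrite (_ : [set v | _] = `]K, +oo[%classic)//.
by apply/seteqP; split => v /=; rewrite in_itv/= andbT.
Qed.

Let mV0 B : measurable B -> measurable (V 0%N @^-1` B).
Proof. by move=> mB; rewrite -[X in measurable X]setTI; exact: iidV.1. Qed.

Lemma tail_probability_small (e : R) : 0 < e ->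
  exists K : nat, fine (P (V 0%N @^-1` [set v | K%:R < v])) <= e.
Proof.
move=> e0; pose F (K : nat) := V 0%N @^-1` [set v | K%:R < v].
have mF K : measurable (F K) by exact: mV0.
have : P (F K) @[K --> \oo] --> P (\bigcap_K F K).
  apply: nonincreasing_cvg_mu => //.
  - by rewrite ltey_eq fin_num_measure.
  - exact: bigcapT_measurable.
  - move=> m n mn; apply/subsetPset => w; rewrite /F/=; apply: le_lt_trans.
    by rewrite ler_nat.
rewrite (_ : \bigcap_K F K = set0) ?measure0; last first.
  apply/seteqP; split => // w /(_ (Num.truncn (V 0%N w)).+1 I) /=.
  by rewrite /F/= ltNge ltW// truncnS_gt.
move=> /fine_cvgP[_] /cvgrPdist_le/(_ _ e0)[N _ hN].
exists N; have := hN N (leqnn N) => /=.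
by rewrite sub0r normrN ger0_norm ?fine_ge0.
Qed.

(** As the perturbations may have no mean, the strong law is applied to the
    indicators of V > K, for a level K exceeded with small probability. *)
Lemma exceedances_linear :
  {ae P, forall w, forall delta, 0 < delta ->
    exists K C : R, forall n, \sum_(i < n) (K < V i w)%R%:R <= C + delta * n%:R}.
Proof.
pose q (K : nat) := fine (P (V 0%N @^-1` [set v | K%:R < v])).
have key : {ae P, forall w (K : nat), forall e, 0 < e -> exists C, forall n,
    `|\sum_(i < n) (K%:R < V i w)%R%:R - q K * n%:R| <= C + e * n%:R}.
  apply: ae_foralln => K.
  pose g (v : R) : R := \1_[set v | K%:R < v] v.
  have mg : measurable_fun setT g by exact: measurable_indic.
  have iidI := iid_comp mg iidV.
  have gE i w : (g \o V i) w = (K%:R < V i w)%R%:R.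
    rewrite /g/= indicE; case: ltP => h; first by rewrite mem_set.
    by rewrite memNset//= ltNge h.
  have gV : g \o V 0%N = \1_(V 0%N @^-1` [set v | K%:R < v]).
    by [].
  have iI : P.-integrable setT (EFin \o (g \o V 0%N)).
    by rewrite gV; apply: integrable_indic => //; exact: mV0.
  have EI : (\int[P]_w ((g \o V 0%N) w)%:E = (q K)%:E)%E.
    rewrite gV integral_indic//; last exact: mV0.
    by rewrite setIT /q fineK// fin_num_measure//; exact: mV0.
  apply: filterS (strong_law_linear iidI iI EI) => w h e e0.
  have [C hC] := h e e0; exists C => n.
  by have := hC n; under eq_bigr do rewrite gE.
apply: filterS key => w h delta d0.
have d2 : 0 < delta / 2 by rewrite divr_gt0.
have [K hK] := tail_probability_small d2.
have [C hC] := h K _ d2.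
exists K%:R, C => n; have := hC n; rewrite ler_norml => /andP[_].
have : q K * n%:R <= delta / 2 * n%:R by rewrite ler_wpM2r.
by lra.
Qed.

End exceedances.

(** * The limit theorem *)

Section integrals.
Context d (T : measurableType d) (R : realType) (P : probability T R).
Local Open Scope ereal_scope.

(** The integral is the difference of those of the positive and negative parts,
    and oo - oo counts as - oo, so a finite value forces both to be finite. *)
Lemma integrable_of_fin_num (f : T -> \bar R) :
  measurable_fun setT f -> \int[P]_w f w \is a fin_num -> P.-integrable setT f.
Proof.
move=> mf; rewrite integralE => hf; apply/integrableP; split => //.
have -> : \int[P]_w `|f w| = \int[P]_w f^\+ w + \int[P]_w f^\- w.
  rewrite -ge0_integralD//; [|exact: measurable_funepos|exact: measurable_funeneg].
  by rewrite -[fun w => `|f w|]/(abse \o f) fune_abse.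
have p0 : 0 <= \int[P]_w f^\+ w by exact: integral_ge0.
have n0 : 0 <= \int[P]_w f^\- w by exact: integral_ge0.
move: hf p0 n0; move: (\int[P]_w f^\+ w) (\int[P]_w f^\- w).
by move=> [a| |] [b| |]//= _ _ _; rewrite -EFinD ltry.
Qed.

Lemma same_law_integral d' (S : measurableType d') (X Y : {RV P >-> S})
    (f : S -> \bar R) :
  measurable_fun setT f -> same_law X Y ->
  \int[P]_w f (X w) = \int[P]_w f (Y w).
Proof.
move=> mf XY.
have ge0 g : measurable_fun setT g -> (forall u, 0 <= g u) ->
    \int[P]_w g (X w) = \int[P]_w g (Y w).
  move=> mg g0.
  have <- := ge0_integral_distribution X mg g0.
  have <- := ge0_integral_distribution Y mg g0.
  by apply: eq_measure_integral => B mB _; exact: XY.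
have parts (Z : {RV P >-> S}) : \int[P]_w f (Z w) =
    \int[P]_w f^\+ (Z w) - \int[P]_w f^\- (Z w).
  by rewrite [LHS]integralE (funepos_comp f Z) (funeneg_comp f Z).
rewrite [LHS]parts [RHS]parts (ge0 f^\+) ?(ge0 f^\-)//.
- exact: measurable_funeneg.
- exact: measurable_funepos.
Qed.

End integrals.

(* An infinite or undefined expectation takes an infinite value in the library,
   so [hmu] entails that xi is integrable. *)
Theorem theorem2p6 (d : measure_display) (T : measurableType d) (R : realType)
    (P : probability T R)
    (xi_eta : {RV P >-> (R * R)%type}) (X : nat -> {RV P >-> (R * R)%type})
    (hX : independent_copies X xi_eta)
    (mu : R) (hmu : ('E_P[fun w => (xi_eta w).1] = mu%:E)%E) (mu_gt0 : 0 < mu)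
    (hfin : exists t : R,
       {ae P, forall w, (visits X t w < +oo)%E} \/
       {ae P, forall w, (last_exit X t w < +oo)%E}) :
  {ae P, forall w,
    ((visits X t w / t%:E)%E @[t --> +oo%R] --> (mu^-1)%:E) /\
    ((last_exit X t w / t%:E)%E @[t --> +oo%R] --> (mu^-1)%:E)}.
Proof.
have iidX := iid_of_independent_copies hX.
have mfst : measurable_fun setT (fst : R * R -> R) by exact: measurable_fst.
have msnd : measurable_fun setT (snd : R * R -> R) by exact: measurable_snd.
have iidU := iid_comp mfst iidX.
have iidV := iid_comp msnd iidX.
have EU : (\int[P]_w ((fst \o X 1%N) w)%:E = mu%:E)%E.
  have mEfst : measurable_fun setT (fun u : R * R => (u.1)%:E).
    exact/measurable_EFinP.
  rewrite -hmu unlock.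
  exact: (same_law_integral mEfst (hX.2 1%N isT)).
have iU : P.-integrable setT (EFin \o (fst \o X 1%N)).
  apply: integrable_of_fin_num; last by rewrite EU.
  by apply/measurable_EFinP; exact: iidU.1 0%N.
have walk n w : random_walk X n w = \sum_(i < n) (fst \o X i.+1) w.
  by rewrite /random_walk big_add1/= big_mkord.
have slope := strong_law_linear iidU iU EU.
have lower : {ae P, forall w, forall e, 0 < e ->
    exists C, forall n, - C - e * n%:R <= (snd \o X n.+1) w}.
  (* With c = 2 mu the perturbation outweighs the drift, also after the loss of
     mu / 2 allowed to the fluctuations of S. *)
  have [io|//] := lower_bound_dichotomy iidV (2 * mu).
  have [t fin_t] := hfin.
  have visits_oo : {ae P, forall w, visits X t w = +oo%E}.
    apply: filterS2 io slope => w iow slopew.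
    have mu2 : 0 < mu / 2 by rewrite divr_gt0.
    have [C hC] := slopew _ mu2.
    apply: visits_infinite => m.
    pose N := (Num.truncn (2 * (`|C| + `|t|) / mu)).+1.
    have [n mn Vn] := iow (maxn m N); move: mn; rewrite geq_max => /andP[mn Nn].
    exists n => //; rewrite walk.
    have Nt : 2 * (`|C| + `|t|) <= mu * n%:R.
      rewrite [leRHS]mulrC -ler_pdivrMr//.
      by apply: (le_trans (ltW (truncnS_gt _))); rewrite ler_nat.
    have := hC n; rewrite ler_norml => /andP[_ Sn].
    have := ler_norm C; have := ler_norm (- t); rewrite normrN.
    by move: Vn Sn Nt; rewrite /=; set s := \sum_(_ < _) _; lra.
  have fin_visits : {ae P, forall w, (visits X t w < +oo)%E}.
    case: fin_t => //; apply: filterS => w.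
    by apply: le_lt_trans; exact: visits_le_last_exit.
  by apply: filterS2 visits_oo fin_visits => w -> /=; rewrite ltxx.
have upper := exceedances_linear iidV.
apply: filterS3 slope lower upper => w slopew lowerw upperw.
apply: visits_last_exit_cvg => // e e0.
have [C hC] := slopew e e0; exists C => n; by rewrite walk.
Qed.
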